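(* Let $n\in\mathbb{N}$, $n\ge 1$. Suppose $n+1$ is an Hadamard number and $S$ is an $n$-dimensional regular simplex having its vertices at vertices of $Q_n'$. Then for the corresponding interpolation projector $P:C(Q_n')\to\Pi_1(\mathbb{R}^n)$ $$\|P\|_{Q_n'}\leq \sqrt{n+1}.$$
   Context: An Hadamard matrix of order $m$ is an $m\times m$ matrix $\mathbf{H}$ with entries $\pm 1$ satisfying $\mathbf{H}^{-1}=\frac1m\mathbf{H}^T$; $m$ is called an Hadamard number if there exists an Hadamard matrix of order $m$. $Q_n':=[-1,1]^n$. $C(Q_n')$ is the space of continuous functions $f:Q_n'\to\mathbb{R}$ with the norm $\|f\|_{C(Q_n')}:=\max_{x\in Q_n'}|f(x)|$. $\Pi_1(\mathbb{R}^n)$ is the set of real polynomials in $n$ variables of degree $\leq 1$. For a nondegenerate simplex $S\subset Q_n'$ with vertices $x^{(1)},\ldots,x^{(n+1)}$, the interpolation projector $P:C(Q_n')\to\Pi_1(\mathbb{R}^n)$ corresponding to $S$ is defined by $Pf(x^{(j)})=f(x^{(j)})$, $j=1,\ldots,n+1$. $\|P\|_{Q_n'}$ denotes the norm of $P$ as an operator from $C(Q_n')$ to $C(Q_n')$. *)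

(* Defs.v *)
From HB Require Import structures.
From mathcomp Require Import all_boot all_order all_algebra.
From mathcomp Require Import all_classical all_reals all_analysis.
(* Notations left out: they clash with those of MathComp-Analysis. *)
From mathcomp Require Import -(notations) mpoly.

Set Implicit Arguments.
Unset Strict Implicit.
Unset Printing Implicit Defensive.

Import Order.TTheory GRing.Theory Num.Theory.
Import numFieldNormedType.Exports.

Local Open Scope classical_set_scope.
Local Open Scope ring_scope.

(* [invmx H] is [H] itself when [H] is singular, hence the [unitmx] clause. *)
Definition is_hadamard_matrix (R : realType) (m : nat) (H : 'M[R]_m) : Prop :=
  [/\ forall i j, H i j = 1 \/ H i j = -1,
      H \in unitmx
    & invmx H = m%:R^-1 *: H^T].

Definition hadamard_number (R : realType) (m : nat) : Prop :=
  exists H : 'M[R]_m, is_hadamard_matrix H.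

Definition cube (R : realType) (n : nat) : set 'rV[R]_n :=
  [set y | forall i, -1 <= y 0 i <= 1].

Definition is_cube_vertex (R : realType) (n : nat) (y : 'rV[R]_n) : Prop :=
  forall i, y 0 i = 1 \/ y 0 i = -1.

(* The library norm on ['rV[R]_n] is the maximum norm, so the Euclidean distance
   is written out. *)
Definition euclidean_dist (R : realType) (n : nat) (y z : 'rV[R]_n) : R :=
  Num.sqrt (\sum_(i < n) (y 0 i - z 0 i) ^+ 2).

(* A simplex is given by the family of its vertices; it is nondegenerate
   (n-dimensional) when these are affinely independent. *)
Definition nondegenerate_simplex (R : realType) (n : nat)
    (x : 'I_n.+1 -> 'rV[R]_n) : Prop :=
  row_free (\matrix_(j < n) (x (lift ord0 j) - x ord0)).

Definition regular_simplex (R : realType) (n : nat)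
    (x : 'I_n.+1 -> 'rV[R]_n) : Prop :=
  nondegenerate_simplex x /\
  exists d : R, forall i j, i != j -> euclidean_dist (x i) (x j) = d.

(* An element of C(Q) is represented by a function on the whole of ['rV[R]_n]
   of which only the restriction to the cube matters. *)
Definition cont_on_cube (R : realType) (n : nat) (f : 'rV[R]_n -> R) : Prop :=
  {within @cube R n, continuous f}.

(* For f continuous on the cube, which is compact, this supremum is a maximum. *)
Definition cube_norm (R : realType) (n : nat) (f : 'rV[R]_n -> R) : R :=
  sup [set `|f y| | y in @cube R n].

(* Taken in the extended reals, so that an unbounded operator has norm +oo. *)
Definition operator_norm (R : realType) (n : nat)
    (T : ('rV[R]_n -> R) -> ('rV[R]_n -> R)) : \bar R :=
  ereal_sup [set (cube_norm (T f))%:E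
            | f in [set f | cont_on_cube f /\ cube_norm f <= 1]].

(* [msize p] is 1 + the total degree of p (0 for p = 0). *)
Definition degree_le1 (R : realType) (n : nat) (p : mpoly n R) : Prop :=
  (mpoly.msize p <= 2)%N.

Definition poly_fun (R : realType) (n : nat) (p : mpoly n R) :
    'rV[R]_n -> R :=
  fun y => meval (fun i => y 0 i) p.

Definition is_interpolation_projector (R : realType) (n : nat)
    (x : 'I_n.+1 -> 'rV[R]_n)
    (P : ('rV[R]_n -> R) -> mpoly n R) : Prop :=
  forall f, cont_on_cube f ->
    degree_le1 (P f) /\ forall j, poly_fun (P f) (x j) = f (x j).

(* Main.v *)
Require Import Defs.
From HB Require Import structures.
From mathcomp Require Import all_boot all_order all_algebra.
From mathcomp Require Import all_classical all_reals all_analysis.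
From mathcomp Require Import -(notations) mpoly.
From mathcomp Require Import ring lra.

(** Write an affine function as [g y = b . (1, y)] with [b] in [R^(n+1)].  The
    proof shows that [b] is short and that [(1, y)] is not long.

    A regular simplex with vertices [x_j] in [{-1, 1}^n] satisfies
    [x_i . x_j = -1] for all [i != j] ([regular_simplex_dot]): these products
    are all equal, and a linear dependence among the [n + 1] vectors [x_j] of
    [R^n] forces their common value.  So the rows [(1, x_j)] are pairwise
    orthogonal of squared length [n + 1]; they form a Hadamard matrix [A].
    Its transpose is then, up to the same factor, also its left inverse, and
    [\sum_j (g x_j)^2 = |A b|^2 = (n + 1) |b|^2]
    ([regular_simplex_vertex_sqr_sum]).

    If [g = P f] interpolates [f] at the vertices and [|f| <= 1] on the cube,
    the left-hand side is at most [n + 1], so [|b| <= 1].  For [y] in the cube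
    [|(1, y)|^2 <= n + 1], and Cauchy-Schwarz gives
    [|g y| <= |b| |(1, y)| <= sqrt (n + 1)] ([abs_affine_le_on_cube]). *)

Set Implicit Arguments.
Unset Strict Implicit.
Unset Printing Implicit Defensive.

Import Order.TTheory GRing.Theory Num.Theory.
Import numFieldNormedType.Exports.

Local Open Scope classical_set_scope.
Local Open Scope ring_scope.

(** The supremum [cube_norm f] dominates the values of [f] only if these are
    bounded: [sup] of an unbounded set is a default value.  Continuity on the
    compact cube provides the bound. *)
Lemma abs_le_cube_norm (R : realType) (n : nat) (f : 'rV[R]_n -> R)
    (y : 'rV[R]_n) :
  cont_on_cube f -> cube y -> `|f y| <= cube_norm f.
Proof.
move=> fc yQ.
have cQ : compact (@cube R n).
  have -> : @cube R n = [set v | forall i, `[-1, 1]%classic (v ord0 i)].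
    by apply/seteqP; split=> v vQ i /=; have := vQ i; rewrite /= in_itv.
  exact: (@rV_compact R n (fun=> `[-1, 1]%classic) (fun=> @segment_compact R (-1) 1)).
have [M [_ MB]] := compact_bounded (continuous_compact fc cQ).
suff ub : has_ubound [set `|f z| | z in @cube R n].
  by apply: (ub_le_sup ub); exists y.
exists (M + 1) => _ [z zQ <-].
by apply: (MB (M + 1)); [rewrite ltrDl | exists z].
Qed.

Lemma cube_vertex_in_cube (R : realType) (n : nat) (y : 'rV[R]_n) :
  is_cube_vertex y -> cube y.
Proof. by move=> yv i; case: (yv i) => ->; lra. Qed.

Lemma cube_vertex_sqr (R : realType) (n : nat) (y : 'rV[R]_n) i :
  is_cube_vertex y -> y 0 i ^+ 2 = 1.
Proof. by move=> yv; case: (yv i) => ->; rewrite ?sqrrN expr1n. Qed.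

Definition homogenize (R : realType) (n : nat) (y : 'rV[R]_n) : 'rV[R]_(1 + n) :=
  row_mx 1 y.

Lemma homogenize_dot (R : realType) (n : nat) (y z : 'rV[R]_n) :
  \sum_k homogenize y 0 k * homogenize z 0 k = 1 + \sum_i y 0 i * z 0 i.
Proof.
rewrite big_split_ord /= big_ord1 !row_mxEl !mxE eqxx mulr1; congr (_ + _).
by apply: eq_bigr => i _; rewrite !row_mxEr.
Qed.

(** A monomial of degree at most 1 is either constant or a single variable, that
    is, a coordinate of [homogenize y]. *)
Lemma degree_le1_affine (R : realType) (n : nat) (p : mpoly n R) :
  degree_le1 p ->
  exists b : 'cV[R]_(1 + n), forall y, poly_fun p y = (homogenize y *m b) 0 0.
Proof.
move=> dp; rewrite /poly_fun.
have : forall m, m \in msupp p -> (mdeg m < 2)%N.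
  by move=> m mp; apply: leq_trans (msize_mdeg_lt mp) dp.
under eq_exists do under eq_forall do rewrite mevalE.
elim: (msupp p) => [|m s IH] sdeg.
  by exists 0 => y; rewrite big_nil mulmx0 mxE.
have [b bE] : exists b : 'cV[R]_(1 + n), forall y : 'rV[R]_n,
    \sum_(m' <- s) mcoeff m' p * \prod_i y 0 i ^+ m' i = (homogenize y *m b) 0 0.
  by apply: IH => m' m's; apply: sdeg; rewrite inE m's orbT.
suff [c cE] : exists c : 'cV[R]_(1 + n), forall y : 'rV[R]_n,
    \prod_i y 0 i ^+ m i = (homogenize y *m c) 0 0.
  exists (mcoeff m p *: c + b) => y.
  by rewrite big_cons bE cE mulmxDr -scalemxAr !mxE.
have := sdeg m; rewrite inE eqxx => /(_ isT).
case d : (mdeg m) => [|[|//]] _.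
- move/eqP: d; rewrite mdeg_eq0 => /eqP ->.
  exists (delta_mx (lshift n 0) 0) => y; rewrite -colE mxE row_mxEl mxE eqxx.
  by apply: big1 => i _; rewrite mnm0E expr0.
- move/eqP/mdeg1P: d => [i /eqP ->].
  exists (delta_mx (rshift 1 i) 0) => y; rewrite -colE mxE row_mxEr.
  rewrite (bigD1 i) //= mnm1E eqxx expr1 big1 ?mulr1 // => j ji.
  by rewrite mnm1E eq_sym (negbTE ji) expr0.
Qed.

(** The vertices have the same norm and the same mutual distances, so their
    products [x_i . x_j], [i != j], have a common value [c].  A nontrivial
    dependence [\sum_i a_i x_i = 0], multiplied by [x_i], gives
    [a_i (n - c) + c \sum_j a_j = 0]; summing over [i] yields
    [n (1 + c) \sum_j a_j = 0], where [\sum_j a_j != 0] since otherwise all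
    [a_i] would vanish. *)
Lemma regular_simplex_dot (R : realType) (n : nat) (x : 'I_n.+1 -> 'rV[R]_n) :
    (1 <= n)%N -> regular_simplex x -> (forall j, is_cube_vertex (x j)) ->
  forall i j, i != j -> \sum_k x i 0 k * x j 0 k = -1.
Proof.
move=> n1 [nd [d dE]] xv.
pose c : R := n%:R - d ^+ 2 / 2.
have dotii i : \sum_k x i 0 k * x i 0 k = n%:R.
  under eq_bigr do rewrite -expr2 cube_vertex_sqr //.
  by rewrite sumr_const card_ord.
have dist2 i j : \sum_k (x i 0 k - x j 0 k) ^+ 2 =
    n%:R *+ 2 - (\sum_k x i 0 k * x j 0 k) *+ 2.
  rewrite mulr2n -{1}(dotii i) -(dotii j) -big_split /= -sumrMnl -sumrB.
  by apply: eq_bigr => k _; rewrite mulr2n; ring.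
have dotij i j : i != j -> \sum_k x i 0 k * x j 0 k = c.
  move=> ij; rewrite /c -(dE _ _ ij) sqr_sqrtr; last first.
    by apply: sumr_ge0 => k _; exact: sqr_ge0.
  by rewrite dist2; field.
(* If c = n, all edges have length 0, against nondegeneracy. *)
have cn : n%:R - c != 0.
  apply/eqP => cn; have j : 'I_n by exact: Ordinal n1.
  have x0 : x (lift ord0 j) - x ord0 = 0.
    apply/rowP => k; rewrite !mxE; apply/eqP; rewrite -sqrf_eq0; apply/eqP.
    have /psumr_eq0P H : \sum_k (x (lift ord0 j) 0 k - x ord0 0 k) ^+ 2 = 0.
      by rewrite dist2 dotij // -mulrnBl cn mul0rn.
    by apply: H => // i _; exact: sqr_ge0.
  move: nd; rewrite /nondegenerate_simplex => /row_free_inj nd.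
  have := nd 1%N (delta_mx 0 j) 0; rewrite /= -rowE rowK x0 mul0mx => /(_ erefl).
  by move/matrixP/(_ 0 j); rewrite !mxE !eqxx => /eqP; rewrite oner_eq0.
(* [X] has [n.+1] rows but rank at most [n]. *)
pose X := \matrix_i x i.
have [a /sub_kermxP aX a0] : exists2 a : 'rV_n.+1, (a <= kermx X)%MS & a != 0.
  apply/rowV0Pn; rewrite -mxrank_eq0 mxrank_ker -lt0n subn_gt0 ltnS.
  exact: rank_leq_col.
pose s := \sum_i a 0 i.
have aE i : a 0 i * (n%:R - c) + c * s = 0.
  have : (a *m (X *m X^T)) 0 i = 0 by rewrite mulmxA aX mul0mx mxE.
  rewrite mxE /s (bigD1 i) //= [in X in _ -> X](bigD1 i) //=.
  have G j : (X *m X^T) j i = \sum_k x j 0 k * x i 0 k.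
    by rewrite mxE; apply: eq_bigr => k _; rewrite !mxE.
  rewrite G dotii; under eq_bigr => j ji do rewrite G dotij //.
  rewrite -mulr_suml => H; rewrite -[RHS]H; ring.
have s0 : s != 0.
  apply: contra_neq a0 => s0; apply/rowP => i; rewrite mxE.
  by have /eqP := aE i; rewrite s0 mulr0 addr0 mulf_eq0 (negbTE cn) orbF => /eqP.
have : \sum_i (a 0 i * (n%:R - c) + c * s) = 0 by rewrite big1.
rewrite big_split /= -mulr_suml -/s sumr_const card_ord -[_ *+ n.+1]mulr_natr.
have -> : s * (n%:R - c) + c * s * n.+1%:R = s * n%:R * (1 + c).
  by rewrite -natr1; ring.
move/eqP; rewrite !mulf_eq0 (negbTE s0) pnatr_eq0 -leqn0 leqNgt n1 /=.
rewrite addrC addr_eq0 => /eqP c1 i j ij.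
by rewrite dotij.
Qed.

(** The rows [homogenize (x j)] form a square matrix [A] with
    [A *m A^T = n.+1%:R%:M].  Being square, [A] also satisfies
    [A^T *m A = n.+1%:R%:M], so [b |-> A *m b] scales the Euclidean norm. *)
Lemma regular_simplex_vertex_sqr_sum (R : realType) (n : nat)
    (x : 'I_n.+1 -> 'rV[R]_n) (b : 'cV[R]_(1 + n)) :
    (1 <= n)%N -> regular_simplex x -> (forall j, is_cube_vertex (x j)) ->
  \sum_j (homogenize (x j) *m b) 0 0 ^+ 2 = n.+1%:R * \sum_k b k 0 ^+ 2.
Proof.
move=> n1 xreg xv.
pose A : 'M[R]_n.+1 := \matrix_j homogenize (x j).
have sqr_norm m (u : 'cV[R]_m) : \sum_k u k 0 ^+ 2 = (u^T *m u) 0 0.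
  by rewrite mxE; apply: eq_bigr => k _; rewrite mxE expr2.
have N0 : n.+1%:R != 0 :> R by rewrite pnatr_eq0.
have AAT : A *m A^T = n.+1%:R%:M.
  apply/matrixP => i j; rewrite !mxE.
  transitivity (1 + \sum_k x i 0 k * x j 0 k).
    by rewrite -homogenize_dot; apply: eq_bigr => k _; rewrite !mxE.
  case: eqVneq => [->|ij]; last by rewrite regular_simplex_dot // subrr.
  under eq_bigr do rewrite -expr2 cube_vertex_sqr //.
  by rewrite sumr_const card_ord nat1r.
have ATA : A^T *m A = n.+1%:R%:M.
  have /mulmx1C : n.+1%:R^-1 *: A *m A^T = 1%:M.
    by rewrite -scalemxAl AAT scale_scalar_mx mulVf.
  rewrite -scalemxAr => /(congr1 (fun M => n.+1%:R *: M)).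
  by rewrite scalerA mulfV // scale1r => ->; rewrite scale_scalar_mx mulr1.
transitivity (\sum_j (A *m b) j 0 ^+ 2).
  apply: eq_bigr => j _; congr (_ ^+ 2).
  by rewrite !mxE; apply: eq_bigr => k _; rewrite [A j k]mxE.
rewrite !sqr_norm trmx_mul -mulmxA (mulmxA A^T) ATA mul_scalar_mx -scalemxAr.
by rewrite mxE.
Qed.

(** Cauchy-Schwarz for [u = homogenize y] and [b], of norms at most
    [s = sqrt (n + 1)] and [1].  With these bounds known it reduces to the
    weighted inequality [2 s |u_k b_k| <= u_k^2 + s^2 b_k^2], summed over [k]. *)
Lemma abs_affine_le_on_cube (R : realType) (n : nat) (b : 'cV[R]_(1 + n))
    (y : 'rV[R]_n) :
    \sum_k b k 0 ^+ 2 <= 1 -> cube y ->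
  `|(homogenize y *m b) 0 0| <= Num.sqrt n.+1%:R.
Proof.
move=> b1 yQ; set s := Num.sqrt _.
have s2 : s ^+ 2 = n.+1%:R by rewrite sqr_sqrtr ?ler0n.
have s0 : 0 < s by rewrite sqrtr_gt0 ltr0Sn.
have y1 : \sum_k homogenize y 0 k ^+ 2 <= s ^+ 2.
  under eq_bigr do rewrite expr2.
  rewrite homogenize_dot s2 -nat1r lerD2l -[n in leRHS]card_ord -sumr_const.
  by apply: ler_sum => i _; have /andP[] := yQ i; nra.
rewrite mxE -(ler_pM2r s0) -expr2.
have -> : s ^+ 2 = (s ^+ 2 + s ^+ 2 * 1) / 2 by field.
apply: (@le_trans _ _ (\sum_k (homogenize y 0 k ^+ 2 + s ^+ 2 * b k 0 ^+ 2) / 2)).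
  apply: le_trans (ler_wpM2r (ltW s0) (ler_norm_sum _ _ _)) _.
  rewrite mulr_suml; apply: ler_sum => k _.
  rewrite normrM -(real_normK (num_real (homogenize y 0 k))).
  rewrite -(real_normK (num_real (b k 0))).
  by have := sqr_ge0 (`|homogenize y 0 k| - s * `|b k 0|); nra.
rewrite -mulr_suml big_split /= -mulr_sumr ler_pM2r ?invr_gt0 ?ltr0n //.
by apply: lerD => //; rewrite ler_pM2l // exprn_gt0.
Qed.

Theorem theorem2 (R : realType) (n : nat) (hn : (1 <= n)%N)
    (hH : hadamard_number R n.+1)
    (x : 'I_n.+1 -> 'rV[R]_n)
    (hS : regular_simplex x)
    (hvert : forall j, is_cube_vertex (x j))
    (P : ('rV[R]_n -> R) -> mpoly n R)
    (hP : is_interpolation_projector x P) :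
  (operator_norm (fun f => poly_fun (P f)) <= (Num.sqrt (n.+1%:R : R))%:E)%E.
Proof.
apply: ge_ereal_sup => _ [f [fc f1] <-]; rewrite lee_fin.
have [deg interp] := hP f fc.
have [b bE] := degree_le1_affine deg.
apply: ge_sup; first by exists `|poly_fun (P f) (x ord0)|, (x ord0) => //;
  exact: cube_vertex_in_cube.
move=> _ [y yQ <-]; rewrite bE; apply: abs_affine_le_on_cube => //.
have N0 : 0 < n.+1%:R :> R by rewrite ltr0Sn.
rewrite -(ler_pM2l N0) mulr1 -(regular_simplex_vertex_sqr_sum b hn hS hvert).
rewrite -[n.+1 in leRHS]card_ord -sumr_const; apply: ler_sum => j _.
rewrite -bE interp -(real_normK (num_real _)) expr_le1 //.
by apply: le_trans f1; apply: abs_le_cube_norm => //; exact: cube_vertex_in_cube.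
Qed.
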